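(* Let $R$ be a finite ring with unity and $\alpha,x\in R$, and let $K$ be the largest left ideal of $R$ contained in $(x)_\ell\cap\langle\alpha\rangle^\perp$. Then $$C_\alpha(x)=\begin{cases}|[x]_\ell| & \text{if } K=(x)_\ell,\\[4pt] \displaystyle\sum_{\substack{E\subseteq\mathcal{M}_R((x)_\ell)\\ \bigcap_{M\in E}M\subseteq K}}\left|\bigcap_{M\in E}M\right|(-1)^{|E|} & \text{if } K=\bigcap_{M\in E}M \text{ for some } E\subseteq\mathcal{M}_R((x)_\ell),\\[4pt] 0 & \text{otherwise.}\end{cases}$$
   Context: Rings are associative with unity, not necessarily commutative. $(x)_\ell$ is the left ideal generated by $x$ and $[x]_\ell=\{y\in R:(y)_\ell=(x)_\ell\}$. Identify $(R,+)$ with $\mathbb{Z}_{n_1}\times\cdots\times\mathbb{Z}_{n_k}$, write $x=(x_1,\dots,x_k)$, and for $\alpha\in R$ let $\psi_\alpha(x)=\prod_{j=1}^k\omega_{n_j}^{\alpha_jx_j}$ with $\omega_n=e^{2\pi i/n}$. Define $C_\alpha(x)=\sum_{s\in[x]_\ell}\psi_\alpha(s)$ (these values are the eigenvalues of the Cayley graph $\mathrm{Cay}(R,[x]_\ell)$). $\langle\alpha\rangle$ is the cyclic additive subgroup generated by $\alpha$, and $S^\perp=\{y\in R:\psi_s(y)=1\ \forall s\in S\}$. For a left ideal $J$, a maximal $R$-left ideal of $J$ is a left ideal $M$ of $R$ with $M\subsetneq J$ and no left ideal $L$ of $R$ with $M\subsetneq L\subsetneq J$; $\mathcal{M}_R(J)$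 is the set of these; the empty intersection $\bigcap_{M\in\emptyset}M$ is taken to be $J$. The cases are read in order (the first applicable case holds). *)

(* Defs.v *)
From HB Require Import structures.
From mathcomp Require Import all_boot all_order all_algebra all_fingroup.
From mathcomp Require Import reals trigo.
From mathcomp Require Import complex.

Set Implicit Arguments.
Unset Strict Implicit.
Unset Printing Implicit Defensive.

Import GRing.Theory Num.Theory.
Local Open Scope ring_scope.
Local Open Scope complex_scope.

Section LeftIdeals.
Variable A : finPzRingType.
Implicit Types (I J K L M S : {set A}) (x : A).

Definition left_ideal I : bool :=
  [&& 0 \in I,
      [forall u in I, forall v in I, u - v \in I]
    & [forall a : A, forall u in I, a * u \in I]].

Definition gen_left_ideal x : {set A} :=
  \bigcap_(I : {set A} | left_ideal I && (x \in I)) I.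

Definition left_class x : {set A} :=
  [set y | gen_left_ideal y == gen_left_ideal x].

Definition max_left_ideals J : {set {set A}} :=
  [set M | [&& left_ideal M, M \proper J
             & ~~ [exists L, [&& left_ideal L, M \proper L & L \proper J]]]].

Definition is_largest_left_ideal_in K S : Prop :=
  [/\ left_ideal K, K \subset S
    & forall L, left_ideal L -> L \subset S -> L \subset K].

(* The empty intersection is J, whereas \bigcap over set0 would be setT. *)
Definition inter_in J (E : {set {set A}}) : {set A} :=
  if E == set0 then J else \bigcap_(M in E) M.

(* <[a]> in the additive group of A. *)
Definition additive_cycle (a : A) : {set A} := (<[a : (A : finZmodType)]>)%g.

End LeftIdeals.

(* An isomorphism of (A, +) with Z_(n 0) x ... x Z_(n (k-1)).  The factor
   Z_(n j) is 'I_(n j) with addition modulo n j, and not 'Z_(n j), so that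
   n j = 1 is covered; c 0 j : 'I_(n j) forces every n j to be positive. *)
Definition additive_coordinates (A : finPzRingType) (k : nat) (n : 'I_k -> nat)
    (c : A -> {dffun forall j : 'I_k, 'I_(n j)}) : Prop :=
  bijective c /\
  forall (x y : A) (j : 'I_k), c (x + y) j = ((c x j + c y j) %% n j)%N :> nat.

(* exp (2 i pi / n) *)
Definition omega (T : realType) (n : nat) : T[i] :=
  let t : T := 2%:R * pi / n%:R in cos t +i* sin t.

Section Characters.
Variables (T : realType) (A : finPzRingType) (k : nat) (n : 'I_k -> nat).
Variable c : A -> {dffun forall j : 'I_k, 'I_(n j)}.

Definition psi (a x : A) : T[i] :=
  \prod_(j < k) omega T (n j) ^+ (c a j * c x j)%N.

Definition perp (S : {set A}) : {set A} :=
  [set y | [forall s in S, psi s y == 1]].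

Definition class_sum (a x : A) : T[i] := \sum_(s in left_class x) psi a s.

End Characters.

(* Main.v *)
(** Every left ideal [I] is an additive group, so the sum of the character
    [psi alpha] over [I] is [|I|] or [0] according to whether [I] lies in its
    kernel, which is the annihilator of the cyclic group of [alpha].  The
    generators of [J = Rx] are the elements of [J] lying in no maximal
    subideal of [J], so inclusion-exclusion over these maximal subideals
    always gives the formula of the second case.  In the third case its sum is
    empty: with [N] the intersection of all maximal subideals of [J], the
    module [J / N] is semisimple, hence every left ideal between [N] and [J]
    is an intersection of maximal subideals; so [K] does not contain [N], let
    alone a larger intersection. *)
Require Import Defs.
From mathcomp Require Import all_boot all_order all_algebra all_fingroup.
From mathcomp Require Import reals trigo complex.

Set Implicit Arguments.
Unset Strict Implicit.
Unset Printing Implicit Defensive.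

Import GRing.Theory Num.Theory.
Local Open Scope ring_scope.
Local Open Scope complex_scope.

(** * Left ideals and their sums and intersections *)

Section LeftIdealTheory.
Variable A : finPzRingType.
Implicit Types (I J K L M N P : {set A}) (x y u v : A) (E : {set {set A}}).

Lemma left_idealP I :
  reflect [/\ 0 \in I, {in I &, forall u v, u - v \in I}
             & forall a u, u \in I -> a * u \in I]
          (left_ideal I).
Proof.
apply: (iffP and3P) => -[I0 IB IM]; split=> //.
- by move=> u v uI vI; have /forall_inP/(_ _ uI)/forall_inP/(_ _ vI) := IB.
- by move=> a u uI; have /forallP/(_ a)/forall_inP/(_ _ uI) := IM.
- by apply/forall_inP => u uI; apply/forall_inP => v vI; apply: IB.
- by apply/forallP => a; apply/forall_inP => u uI; apply: IM.
Qed.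

Lemma left_ideal0 I : left_ideal I -> 0 \in I.
Proof. by case/left_idealP. Qed.

Lemma left_idealB I : left_ideal I -> {in I &, forall u v, u - v \in I}.
Proof. by case/left_idealP. Qed.

Lemma left_idealM I a u : left_ideal I -> u \in I -> a * u \in I.
Proof. by case/left_idealP => _ _; apply. Qed.

Lemma left_idealD I : left_ideal I -> {in I &, forall u v, u + v \in I}.
Proof.
move=> hI u v uI vI; rewrite -[v]opprK left_idealB // -sub0r.
by rewrite left_idealB ?left_ideal0.
Qed.

Lemma left_ideal_addr I u v :
  left_ideal I -> v \in I -> (u + v \in I) = (u \in I).
Proof.
move=> hI vI; apply/idP/idP => [uvI | uI]; last exact: left_idealD.
by rewrite -(addrK v u) left_idealB.
Qed.

Lemma left_ideal_bigcap (D : pred {set A}) :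
  (forall I, D I -> left_ideal I) -> left_ideal (\bigcap_(I | D I) I).
Proof.
move=> hD; apply/left_idealP; split.
- by apply/bigcapP => I /hD /left_ideal0.
- move=> u v /bigcapP uD /bigcapP vD; apply/bigcapP => I DI.
  by rewrite left_idealB ?hD ?uD ?vD.
- by move=> a u /bigcapP uD; apply/bigcapP => I DI; rewrite left_idealM ?hD ?uD.
Qed.

Lemma left_idealI I J : left_ideal I -> left_ideal J -> left_ideal (I :&: J).
Proof.
move=> hI hJ; apply/left_idealP; split; rewrite ?inE ?left_ideal0 //.
- move=> u v; rewrite !inE => /andP[uI uJ] /andP[vI vJ].
  by rewrite !left_idealB.
- by move=> a u; rewrite !inE => /andP[uI uJ]; rewrite !left_idealM.
Qed.

Definition add_ideal I J : {set A} := [set u + v | u in I, v in J].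

Lemma left_ideal_add I J :
  left_ideal I -> left_ideal J -> left_ideal (add_ideal I J).
Proof.
move=> hI hJ; apply/left_idealP; split.
- by apply/imset2P; exists 0 0; rewrite ?left_ideal0 ?addr0.
- move=> _ _ /imset2P[u v uI vJ ->] /imset2P[u' v' uI' vJ' ->].
  apply/imset2P; exists (u - u') (v - v'); rewrite ?left_idealB //.
  by rewrite opprD addrACA.
- move=> a _ /imset2P[u v uI vJ ->].
  by apply/imset2P; exists (a * u) (a * v); rewrite ?left_idealM ?mulrDr.
Qed.

Lemma add_ideal_subl I J : left_ideal J -> I \subset add_ideal I J.
Proof.
move=> hJ; apply/subsetP => u uI.
by apply/imset2P; exists u 0; rewrite ?addr0 ?left_ideal0.
Qed.

Lemma add_ideal_subr I J : left_ideal I -> J \subset add_ideal I J.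
Proof.
move=> hI; apply/subsetP => u uJ.
by apply/imset2P; exists 0 u; rewrite ?add0r ?left_ideal0.
Qed.

Lemma add_ideal_sub I J P :
  left_ideal P -> I \subset P -> J \subset P -> add_ideal I J \subset P.
Proof.
move=> hP /subsetP IP /subsetP JP; apply/subsetP => _ /imset2P[u v uI vJ ->].
by apply: left_idealD => //; [apply: IP | apply: JP].
Qed.

(** * Principal left ideals and maximal subideals *)

Lemma gen_left_ideal_ideal x : left_ideal (gen_left_ideal x).
Proof. by apply: left_ideal_bigcap => I /andP[]. Qed.

Lemma mem_gen_left_ideal x : x \in gen_left_ideal x.
Proof. by apply/bigcapP => I /andP[]. Qed.

Lemma gen_left_ideal_sub I x :
  left_ideal I -> (gen_left_ideal x \subset I) = (x \in I).
Proof.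
move=> hI; apply/idP/idP => [/subsetP/(_ x)|xI].
  by apply; apply: mem_gen_left_ideal.
by apply: bigcap_inf; rewrite hI.
Qed.

Lemma max_left_idealsP J M :
  reflect [/\ left_ideal M, M \proper J
             & forall L, left_ideal L -> M \subset L -> L \subset J ->
                 ~~ (L \subset M) -> L = J]
          (M \in max_left_ideals J).
Proof.
rewrite inE; apply: (iffP and3P) => -[hM MJ maxM]; split=> //.
  move=> L hL ML LJ LM; apply/eqP; rewrite eqEproper LJ /=.
  apply: contraNN maxM => LJ'; apply/existsP; exists L.
  by rewrite hL LJ' properE ML LM.
apply/existsP => -[L /and3P[hL /andP[ML LM] LJ]].
by move: (LJ); rewrite (maxM L hL ML (proper_sub LJ) LM) properxx.
Qed.

Lemma max_left_ideals_exist I J :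
  left_ideal I -> I \proper J ->
  exists2 M, M \in max_left_ideals J & I \subset M.
Proof.
move=> hI IJ.
have [M /maxsetP[/andP[hM MJ] maxM] IM] :=
  @maxset_exists _ (fun L => left_ideal L && (L \proper J)) I
    (introT andP (conj hI IJ)).
exists M => //; apply/max_left_idealsP; split=> // L hL ML LJ LM.
apply/eqP; rewrite eqEproper LJ; apply: contraNN LM => LJ'.
by rewrite (maxM L) ?hL.
Qed.

(** An element [y] of [J] either generates [J] or generates a proper subideal, which by finiteness
    lies in a maximal one. *)
Lemma mem_left_class x y :
  (y \in left_class x) =
  (y \in gen_left_ideal x) &&
  [forall M in max_left_ideals (gen_left_ideal x), y \notin M].
Proof.
set J := gen_left_ideal x; rewrite inE -/J.
have hJ : left_ideal J := gen_left_ideal_ideal x.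
apply/eqP/andP => [yJ | [yJ /forall_inP yM]].
  rewrite -yJ mem_gen_left_ideal; split=> //; apply/forall_inP => M.
  rewrite yJ => /max_left_idealsP[hM MJ _].
  by rewrite -gen_left_ideal_sub // yJ; case/andP: MJ.
apply/eqP; rewrite eqEproper gen_left_ideal_sub // yJ /=.
apply/negP => /(max_left_ideals_exist (gen_left_ideal_ideal y))[M maxM].
have /max_left_idealsP[hM _ _] := maxM.
by rewrite gen_left_ideal_sub // (negPf (yM M maxM)).
Qed.

Lemma inter_in_ideal J E :
  left_ideal J -> E \subset max_left_ideals J -> left_ideal (inter_in J E).
Proof.
move=> hJ /subsetP EJ; rewrite /inter_in; case: ifP => // _.
by apply: left_ideal_bigcap => M /EJ /max_left_idealsP[].
Qed.

(** This form needs no case distinction: the condition [y \in J] decides the case of empty [E], and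
    follows from membership in any [M] of a nonempty [E]. *)
Lemma mem_inter_in J E y :
  E \subset max_left_ideals J ->
  (y \in inter_in J E) = (y \in J) && [forall M in E, y \in M].
Proof.
move=> /subsetP EJ; rewrite /inter_in; case: eqP => [->|/eqP/set0Pn[M ME]].
  by rewrite (introT forall_inP) ?andbT // => M; rewrite inE.
apply/bigcapP/andP => [yE | [_ /forall_inP//]]; split; last exact/forall_inP.
by have /max_left_idealsP[_ /proper_sub/subsetP + _] := EJ M ME; apply; apply: yE.
Qed.

Lemma inter_in_sub J E :
  E \subset max_left_ideals J -> inter_in J E \subset J.
Proof. by move=> EJ; apply/subsetP => y; rewrite mem_inter_in // => /andP[]. Qed.

(** * Supplements, and ideals above the intersection of all maximal subideals *)

Lemma max_left_ideals_split J M L P :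
  left_ideal J -> M \in max_left_ideals J -> left_ideal L -> L \subset J ->
  left_ideal P -> P \subset L -> ~~ (P \subset M) ->
  L \subset add_ideal (L :&: M) P.
Proof.
move=> hJ /max_left_idealsP[hM MJ maxM] hL LJ hP PL PM.
have MPJ : add_ideal M P = J.
  apply: maxM; first exact: left_ideal_add.
  - exact: add_ideal_subl.
  - by apply: add_ideal_sub; rewrite ?(proper_sub MJ) // (subset_trans PL).
  - by apply: contra PM; apply: subset_trans; apply: add_ideal_subr.
(* Modular law: in [l = m + p] the term [p] lies in [L], hence so does [m]. *)
apply/subsetP => l lL; have := subsetP LJ l lL.
rewrite -MPJ => /imset2P[m p mM pP El]; have pL := subsetP PL p pP.
apply/imset2P; exists m p; rewrite // inE mM andbT.
by rewrite -(left_ideal_addr m hL pL) -El.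
Qed.

(** Take [L] minimal with [K + L = J]. If a maximal [M] missed some element of [K :&: L], then [L]
    would be the sum of [L :&: M] and [K :&: L]. The second summand is absorbed by [K], so [L :&: M]
    would supplement [K] too, and minimality would put [L] inside [M]. *)
Lemma left_ideal_supplement J K :
  left_ideal J -> left_ideal K -> K \subset J ->
  exists L, [/\ left_ideal L, L \subset J, J \subset add_ideal K L,
    K :&: L \subset inter_in J (max_left_ideals J)
  & forall P, left_ideal P -> P \subset L -> J \subset add_ideal K P ->
      L \subset P].
Proof.
move=> hJ hK KJ.
pose supp L := [&& left_ideal L, L \subset J & J \subset add_ideal K L].
have suppJ : supp J by rewrite /supp hJ subxx add_ideal_subr.
have [L /minsetP[/and3P[hL LJ JKL] minL] _] := @minset_exists _ supp J suppJ.
have {}minL P : left_ideal P -> P \subset L -> J \subset add_ideal K P ->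
    L \subset P.
  by move=> hP PL JKP; rewrite (minL P) // /supp hP JKP (subset_trans PL).
exists L; split=> //; apply/subsetP => y yKL; rewrite mem_inter_in //.
have /setIP[yK yL] := yKL; rewrite (subsetP KJ y yK).
apply/forall_inP => M maxM; apply: contraT => yM.
have /max_left_idealsP[hM _ _] := maxM.
suff /subsetP/(_ y yL) : L \subset L :&: M by rewrite inE (negPf yM) andbF.
have hLM := left_idealI hL hM.
apply: minL; rewrite ?subsetIl //; apply: (subset_trans JKL).
apply: add_ideal_sub; rewrite ?left_ideal_add ?add_ideal_subl //.
have LLMKL := max_left_ideals_split hJ maxM hL LJ (left_idealI hK hL)
  (subsetIr K L) (introN subsetP (fun H => negP yM (H y yKL))).
apply: (subset_trans LLMKL).
apply: add_ideal_sub; rewrite ?left_ideal_add ?add_ideal_subr //.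
by rewrite (subset_trans (subsetIl K L)) ?add_ideal_subl.
Qed.

(* [J / N] is semisimple for [N] the intersection of the maximal subideals:
   with [L] a minimal supplement of [K] in [J], and [M] a maximal subideal
   avoiding the [L]-component of [y], [K + (L :&: M)] is maximal. *)
Lemma max_left_ideals_separate J K y :
  left_ideal J -> left_ideal K -> K \subset J ->
  inter_in J (max_left_ideals J) \subset K -> y \in J -> y \notin K ->
  exists M, [/\ M \in max_left_ideals J, K \subset M & y \notin M].
Proof.
move=> hJ hK KJ NK yJ yK.
have [L [hL LJ JKL KLN minL]] := left_ideal_supplement hJ hK KJ.
have /imset2P[k l kK lL Ey] := subsetP JKL y yJ.
have lK : l \notin K.
  by apply: contra yK => lK; rewrite Ey left_idealD.
have /forall_inPn[M maxM lM] : ~~ [forall M in max_left_ideals J, l \in M].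
  apply: contra lK => lN; apply: (subsetP NK).
  by rewrite mem_inter_in // (subsetP LJ).
have /max_left_idealsP[hM _ _] := maxM.
have hLM := left_idealI hL hM.
have KLM_M u : u \in K -> u \in L -> u \in M.
  move=> uK uL; have := subsetP KLN u; rewrite inE uK uL => /(_ isT).
  by rewrite mem_inter_in // => /andP[_ /forall_inP/(_ M maxM)].
pose Q := add_ideal K (L :&: M).
have hQ : left_ideal Q by apply: left_ideal_add.
have KQ : K \subset Q by apply: add_ideal_subl.
have QJ : Q \subset J.
  by rewrite add_ideal_sub // (subset_trans (subsetIl L M)).
(* If [l = k' + m] with [m] in [L :&: M], then [k' = l - m] lies in [K :&: L], hence in [M], and so
   does [l]. *)
have lQ : l \notin Q.
  apply: contra lM => /imset2P[k' m k'K /setIP[mL mM] El].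
  by rewrite El left_ideal_addr // KLM_M // -(left_ideal_addr k' hL mL) -El.
have yQ : y \notin Q.
  by rewrite Ey addrC left_ideal_addr // (subsetP KQ).
exists Q; split=> //; apply/max_left_idealsP; split=> //.
  by rewrite properE QJ; apply/subsetPn; exists y.
move=> P hP QP PJ PQ; apply/eqP; rewrite eqEsubset PJ /=.
have KP := subset_trans KQ QP.
apply: (subset_trans JKL); apply: add_ideal_sub => //.
have hPL := left_idealI hP hL.
(* Since [K] lies in [P], the [L]-component of an element of [P] is again in [P]; were [P :&: L]
   inside [M], all of [P] would lie in [Q]. *)
have PLM : ~~ (P :&: L \subset M).
  apply: contra PQ => /subsetP PLM; apply/subsetP => p pP.
  have /imset2P[k' l' k'K l'L Ep] := subsetP JKL p (subsetP PJ p pP).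
  have l'P : l' \in P.
    by rewrite -(left_ideal_addr l' hP (subsetP KP k' k'K)) addrC -Ep.
  by apply/imset2P; exists k' l'; rewrite // inE l'L PLM // inE l'P.
have := max_left_ideals_split hJ maxM hL LJ hPL (subsetIr P L) PLM.
move/subset_trans; apply.
apply: add_ideal_sub; rewrite ?subsetIl //.
by apply: subset_trans QP; apply: add_ideal_subr.
Qed.

(** Each element of [J] outside [K] is excluded by some maximal subideal containing [K]. *)
Lemma left_ideal_inter_in J K :
  left_ideal J -> left_ideal K -> K \subset J ->
  inter_in J (max_left_ideals J) \subset K ->
  K = inter_in J [set M in max_left_ideals J | K \subset M].
Proof.
move=> hJ hK KJ NK; apply/setP => y.
have EJ : [set M in max_left_ideals J | K \subset M] \subset max_left_ideals J.
  by apply/subsetP => M; rewrite inE => /andP[].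
rewrite mem_inter_in //; apply/idP/andP => [yK | [yJ /forall_inP yE]].
  split; first exact: (subsetP KJ).
  by apply/forall_inP => M; rewrite inE => /andP[_ /subsetP]; apply.
apply: contraT => yK.
have [M [maxM KM yM]] := max_left_ideals_separate hJ hK KJ NK yJ yK.
by rewrite -(negPf yM) yE // inE maxM.
Qed.

End LeftIdealTheory.

(** * Sums of an additive character over left ideals and over generators *)

Section CharacterSums.
Variables (A : finPzRingType) (F : idomainType) (f : A -> F).
Hypothesis fD : {morph f : u v / u + v >-> u * v}.
Implicit Types (I J : {set A}).

(** Translation by [v] in [I] permutes [I] and multiplies the sum by [f v]; if [f v] is not 1, the
    sum vanishes because [F] is a domain. *)
Lemma character_sum I :
  left_ideal I ->
  \sum_(u in I) f u =
    if [forall u in I, f u == 1] then #|I|%:R else 0.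
Proof.
move=> hI; case: ifPn => [/forall_inP f1 | /forall_inPn[v vI fv]].
  rewrite -sumr_const; apply: eq_bigr => u uI; exact/eqP/f1.
have : \sum_(u in I) f u = (\sum_(u in I) f u) * f v.
  rewrite mulr_suml (reindex_inj (addIr v)) /=.
  by apply: eq_big => u; rewrite ?left_ideal_addr // fD.
move/eqP; rewrite -subr_eq0 -{1}[\sum_(u in I) _]mulr1 -mulrBr mulf_eq0.
by rewrite subr_eq0 [1 == _]eq_sym (negPf fv) orbF => /eqP.
Qed.

(** Inclusion-exclusion: on [J] the indicator of the class is the product over maximal [M] of one
    minus the indicator of [M], expanded over subsets. *)
Lemma left_class_sum x :
  let J := gen_left_ideal x in
  \sum_(s in left_class x) f s =
    \sum_(E : {set {set A}} | E \subset max_left_ideals J)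
      (-1) ^+ #|E| * \sum_(s in inter_in J E) f s.
Proof.
move=> J; pose Mx := max_left_ideals J.
(* The value 0 off [Mx] allows a product over all sets: such factors [g s M + 1] are 1, and the
   expansion terms with [E] not inside [Mx] vanish. *)
pose g (s : A) M : F := - (if M \in Mx then (s \in M)%:R else 0).
have gE s : s \in J ->
  (s \in left_class x)%:R =
    \sum_(E : {set {set A}} | E \subset Mx)
      (-1) ^+ #|E| * (s \in inter_in J E)%:R :> F.
  move=> sJ; transitivity (\prod_M (g s M + 1)).
    rewrite mem_left_class -/J sJ /=.
    case: (boolP [forall M in _, _]) => [/forall_inP sM|].
      rewrite big1 // => M _; rewrite /g; case: ifP => [MM|]; last first.
        by rewrite oppr0 add0r.
      by rewrite (negPf (sM M MM)) oppr0 add0r.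
    case/forall_inPn => M MM /negPn sM.
    by rewrite (bigD1 M) //= /g MM sM addNr mul0r.
  rewrite bigA_distr [RHS]big_mkcond; apply: eq_bigr => E _.
  rewrite -big_mkcond /=; case: ifPn => [EM | /subsetPn[M ME MM]]; last first.
    by rewrite (bigD1 M) //= /g (negPf MM) oppr0 mul0r.
  rewrite mem_inter_in // sJ /= prodrN; congr (_ * _).
  case: (boolP [forall M in E, _]) => [/forall_inP sE|/forall_inPn[M ME sM]].
    by rewrite big1 // => M ME; rewrite (subsetP EM) // sE.
  by rewrite (bigD1 M) //= (subsetP EM) // (negPf sM) mul0r.
transitivity (\sum_(s in J) (s \in left_class x)%:R * f s).
  rewrite big_mkcond [RHS]big_mkcond /=; apply: eq_bigr => s _.
  rewrite mem_left_class -/J; case: (s \in J) => //=.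
  by case: [forall M in _, _]; rewrite ?mul1r ?mul0r.
rewrite (eq_bigr _ (fun s sJ => congr1 (fun z => z * f s) (gE s sJ))).
under eq_bigr do rewrite mulr_suml.
rewrite exchange_big /=; apply: eq_bigr => E EM; rewrite mulr_sumr.
rewrite big_mkcond [RHS]big_mkcond /=; apply: eq_bigr => s _.
rewrite mem_inter_in //; case: (s \in J) => //=.
by case: ifP; rewrite ?mulr1 ?mulr0 ?mul0r.
Qed.

End CharacterSums.

(** * The characters defined by coordinates *)

Section CoordinateCharacters.
Variables (T : realType) (A : finPzRingType) (k : nat) (n : 'I_k -> nat).
Variable c : A -> {dffun forall j : 'I_k, 'I_(n j)}.
Hypothesis hc : additive_coordinates c.

Lemma omega_expn m : (0 < m)%N -> omega T m ^+ m = 1.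
Proof.
move=> m0; rewrite /omega; set t := 2%:R * pi / m%:R.
have deMoivre p : (cos t +i* sin t) ^+ p = cos (t *+ p) +i* sin (t *+ p).
  elim: p => [|p IHp]; first by rewrite mulr0n cos0 sin0.
  rewrite exprS IHp mulrS cosD sinD; congr (_ +i* _).
  by rewrite addrC.
rewrite deMoivre -mulr_natr divfK ?pnatr_eq0 -?lt0n //.
by rewrite mulr_natl cos2pi sin2pi.
Qed.

Lemma psiC a u : psi T c a u = psi T c u a.
Proof. by apply: eq_bigr => j _; rewrite mulnC. Qed.

(** Coordinates add only modulo [n j], which is harmless since [omega T (n j)] is an [n j]-th root
    of unity. *)
Lemma psiDr a : {morph psi T c a : u v / u + v >-> u * v}.
Proof.
move=> u v; rewrite /psi -big_split; apply: eq_bigr => j _ /=.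
have nj : (0 < n j)%N := leq_ltn_trans (leq0n _) (ltn_ord (c a j)).
have omega_mod e : omega T (n j) ^+ (e %% n j) = omega T (n j) ^+ e.
  by rewrite expr_mod ?omega_expn.
by rewrite -exprD -mulnDr hc.2 -omega_mod modnMmr omega_mod.
Qed.

Lemma psi_neq0 a u : psi T c a u != 0.
Proof.
apply/prodf_neq0 => j _; apply/expf_neq0.
have nj : (0 < n j)%N := leq_ltn_trans (leq0n _) (ltn_ord (c a j)).
apply/eqP => w0; have /eqP := omega_expn nj.
by rewrite w0 expr0n eqn0Ngt nj eq_sym oner_eq0.
Qed.

(** Without computing [c 0]: additivity makes the value at 0 equal to its own square, and it is
    nonzero. *)
Lemma psir0 a : psi T c a 0 = 1.
Proof.
by apply: (mulfI (psi_neq0 a 0)); rewrite -psiDr addr0 mulr1.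
Qed.

Lemma psiMnr a u m : psi T c a (u *+ m) = psi T c a u ^+ m.
Proof.
by elim: m => [|m IHm]; rewrite ?psir0 // mulrS psiDr IHm exprS.
Qed.

(** By the symmetry [psiC], replacing [a] by a multiple of it raises the value at [y] to a power, so
    the generator alone decides. *)
Lemma mem_perp_cycle a y :
  (y \in perp T c (additive_cycle a)) = (psi T c a y == 1).
Proof.
rewrite inE /additive_cycle; apply/forall_inP/eqP => [psi1 | psi1 s].
  by apply/eqP/psi1; exact: (@cycle_id _ (a : (A : finZmodType))).
case/(@cycleP _ (a : (A : finZmodType))) => m ->; rewrite FinRing.zmodXgE.
by apply/eqP; rewrite psiC psiMnr psiC psi1 expr1n.
Qed.

End CoordinateCharacters.

Theorem theorem4p4 (T : realType) (A : finPzRingType)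
    (k : nat) (n : 'I_k -> nat) (c : A -> {dffun forall j : 'I_k, 'I_(n j)})
    (hc : additive_coordinates c)
    (alpha x : A) (K : {set A})
    (hK : is_largest_left_ideal_in K
            (gen_left_ideal x :&: perp T c (additive_cycle alpha))) :
  class_sum T c alpha x =
    let J := gen_left_ideal x in
    if K == J then #|left_class x|%:R
    else if [exists E : {set {set A}},
               (E \subset max_left_ideals J) && (K == inter_in J E)]
    then \sum_(E : {set {set A}} |
                 (E \subset max_left_ideals J) && (inter_in J E \subset K))
           #|inter_in J E|%:R * (-1) ^+ #|E|
    else 0.
Proof.
rewrite /=; set J := gen_left_ideal x.
case: hK; rewrite -/J subsetI => hK /andP[KJ Kperp] maxK.
have hJ : left_ideal J := gen_left_ideal_ideal x.
have [KeqJ | _] := eqVneq K J.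
  rewrite /class_sum -sumr_const; apply: eq_bigr => s.
  rewrite mem_left_class -/J => /andP[sJ _]; apply/eqP.
  by rewrite -(mem_perp_cycle T hc) (subsetP Kperp) // KeqJ.
have sumE : class_sum T c alpha x =
    \sum_(E : {set {set A}} |
            (E \subset max_left_ideals J) && (inter_in J E \subset K))
      #|inter_in J E|%:R * (-1) ^+ #|E|.
  rewrite /class_sum (left_class_sum (psi T c alpha)) -/J big_mkcondr.
  apply: eq_bigr => E EM; have hE := inter_in_ideal hJ EM.
  rewrite (character_sum (psiDr T hc alpha) hE) mulrC.
  suff -> : [forall u in inter_in J E, psi T c alpha u == 1] =
            (inter_in J E \subset K) by case: ifP; rewrite ?mul0r.
  (* The intersection is a left ideal inside [J]; if the character is trivial on it, it lies in [K]
     because [K] is largest. *)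
  apply/forall_inP/idP => [psi1 | /subsetP EK u /EK uK].
    apply: maxK => //; rewrite subsetI inter_in_sub //=.
    by apply/subsetP => u /psi1; rewrite (mem_perp_cycle T hc).
  by rewrite -(mem_perp_cycle T hc) (subsetP Kperp).
case: ifPn => [_ // | /existsPn noE]; rewrite sumE big1 // => E /andP[EM EK].
(* Third case: a single term of the sum would put the intersection of all maximal subideals inside
   [K], and [K] would be the intersection of [E0]. *)
set E0 := [set M in max_left_ideals J | K \subset M].
have E0M : E0 \subset max_left_ideals J.
  by apply/subsetP => M; rewrite inE => /andP[].
have /negP[] := noE E0; rewrite E0M; apply/eqP/left_ideal_inter_in => //.
apply: subset_trans EK; apply/subsetP => u; rewrite !mem_inter_in //.
case/andP=> -> /forall_inP uM; apply/forall_inP => M ME.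
by rewrite uM // (subsetP EM).
Qed.
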